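(* Let $S$ be a metric signature, let $L$ be a countable fragment of $\mathcal{L}_{\omega_1,\omega}(S)$ (the $[0,1]$-valued infinitary logic for metric structures), and let $T$ be an $L$-theory. For each $n<\omega$ let $\Sigma_n$ be a type of $T$, in finitely many variables (the number of variables may depend on $n$), that is not principal over $T$. Then there is a model $\mathcal{M}$ of $T$ that omits every $\Sigma_n$, i.e. for every $n$ no tuple of elements of $\mathcal{M}$ realizes $\Sigma_n$.
   Context: Metric structures. A metric structure $\mathcal{M}$ consists of a metric space $(M,d)$ with $d\le 1$ (not necessarily complete), together with sets of uniformly continuous functions $M^n\to M$, of uniformly continuous predicates $M^n\to[0,1]$, and of distinguished elements; $M^n$ carries the sup metric. A metric signature $S$ consists of function symbols and predicate symbols, each with an arity and a modulus of continuity $\delta:\mathbb{Q}\cap(0,1)\to\mathbb{Q}\cap(0,1)$, and constant symbols. An $S$-structure interprets each symbol respecting its modulus: $\sup_i d(a_i,b_i)<\delta(\epsilon)$ implies $d(f(\bar a),f(\bar b))\le\epsilon$ for function symbols, resp. $|P(\bar a)-P(\bar b)|\le\epsilon$ for predicate symbols. Formulas. Terms are as in first-order logic. Atomic formulas: $d(t_1,t_2)$ and $P(t_1,\dots,t_n)$ for terms $t_i$. Formulas of $\mathcal{L}_{\omega_1,\omega}(S)$ are built from atomic formulas and constants $q\in\mathbb{Q}\cap[0,1]$ by $\varphi\to\psi$, by $\sup_x\varphi$, and by $\sup_{n<\omega}\varphi_n$ when the total number of free variables in all $\varphi_n$ is finite. Truth values $\varphi^{\mathcal{M}}(\bar a)\in[0,1]$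 are defined by recursion: atomic formulas and constants in the obvious way, $(\psi\to\theta)^{\mathcal M}=\min\{1-\psi^{\mathcal M}+\theta^{\mathcal M},1\}$, and $\sup_{n}$, $\sup_x$ are suprema over $n<\omega$ and over $x\in M$. $\mathcal{M}\models\varphi(\bar a)$ means $\varphi^{\mathcal M}(\bar a)=1$. Abbreviation: $\neg\varphi=(\varphi\to 0)$, with value $1-\varphi$. For rational $r$, ''$\varphi\ge r$'' is the formula $r\to\varphi$. Fragments. A fragment of $\mathcal{L}_{\omega_1,\omega}(S)$ is a set $L$ of $\mathcal{L}_{\omega_1,\omega}(S)$-formulas that contains every atomic formula and every constant formula $q\in\mathbb{Q}\cap[0,1]$, is closed under $\sup_x$, $\to$ and $\neg$, and is closed under substituting terms for variables. An $L$-theory is a set of $L$-sentences; a model of $T$ is an $S$-structure satisfying every sentence of $T$. Types. A set $\Sigma(x_1,\dots,x_n)$ of $L$-formulas is a type of $T$ if it is realized in some model of $T$: there are $\mathcal{M}\models T$ and $a_1,\dots,a_n\in M$ with $\mathcal{M}\models\varphi(a_1,\dots,a_n)$ for all $\varphi\in\Sigma$. A type $\Sigma(x_1,\dots,x_n)$ of $T$ is principal over $T$ if there are an $L$-formula $\varphi(\bar y)$, terms $t_1(\bar y),\dots,t_n(\bar y)$ (with $\bar y$ a finite tuple of variables) and $r\in\mathbb{Q}\cap(0,1)$ such that (i) $T\cup\{\varphi(\bar y)\}$ is satisfiable, i.e. there are $\mathcal M\models T$ and $\bar b$ in $M$ with $\varphi^{\mathcal M}(\bar b)=1$; and (ii)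 $T\cup\{\varphi(\bar y)\ge r\}\models\Sigma(t_1(\bar y),\dots,t_n(\bar y))$, i.e. for all $\mathcal{M}\models T$ and $\bar b$ in $M$ with $\varphi^{\mathcal M}(\bar b)\ge r$, the tuple $(t_1^{\mathcal M}(\bar b),\dots,t_n^{\mathcal M}(\bar b))$ realizes $\Sigma$.
   Formalization: The fragment L is additionally required to be closed under subformulas (the standard clause); without it the claim fails, e.g. when T contains sup_x inf_k P_k(x) as a sentence of L whose subformulas are not in L. *)

(* Defs.v *)
From HB Require Import structures.
From mathcomp Require Import all_boot all_order all_algebra.
From mathcomp Require Import all_classical all_reals.
From mathcomp Require Import metric_structure.

Set Implicit Arguments.
Unset Strict Implicit.
Unset Printing Implicit Defensive.

Import Order.TTheory GRing.Theory Num.Theory.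

Local Open Scope classical_set_scope.
Local Open Scope ring_scope.

Definition rat_oo : Type := {q : rat | 0 < q < 1}.
Definition rat_cc : Type := {q : rat | 0 <= q <= 1}.

Record signature : Type := Signature {
  fsym : Type;
  psym : Type;
  csym : Type;
  farity : fsym -> nat;
  parity : psym -> nat;
  fmod : fsym -> rat_oo -> rat_oo;
  pmod : psym -> rat_oo -> rat_oo }.

(* Syntax is well-scoped de Bruijn: a term or formula over n has its free
   variables among 'I_n, so formulas are identified up to renaming of bound
   variables. *)
Inductive term (S : signature) (n : nat) : Type :=
| TVar of 'I_n
| TConst of csym S
| TFun (f : fsym S) of ('I_(farity f) -> term S n).

Arguments TVar {S n} _.
Arguments TConst {S n} _.
Arguments TFun {S n} f _.

(* FSupx binds the variable ord0 of its argument.  In FSupn the family is over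
   a single n: this is the requirement that the phi_k have, altogether, only
   finitely many free variables. *)
Inductive formula (S : signature) : nat -> Type :=
| FDist n of term S n & term S n : formula S n
| FPred n (P : psym S) of ('I_(parity P) -> term S n) : formula S n
| FConst n of rat_cc : formula S n
| FImp n of formula S n & formula S n : formula S n
| FSupx n of formula S n.+1 : formula S n
| FSupn n of (nat -> formula S n) : formula S n.

Arguments FDist {S n} _ _.
Arguments FPred {S n} P _.
Arguments FConst {S n} _.
Arguments FImp {S n} _ _.
Arguments FSupx {S n} _.
Arguments FSupn {S n} _.

Notation sentence S := (formula S 0).

Definition rat_cc0 : rat_cc := exist (fun q : rat => is_true (0 <= q <= 1)) 0 isT.

Definition FNot (S : signature) n (phi : formula S n) : formula S n :=
  FImp phi (FConst rat_cc0).

Definition ord_cons (A : Type) n (a : A) (v : 'I_n -> A) (i : 'I_n.+1) : A :=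
  if unlift ord0 i is Some j then v j else a.

Fixpoint tsubst (S : signature) m n (s : 'I_m -> term S n) (t : term S m)
    : term S n :=
  match t with
  | TVar i => s i
  | TConst c => TConst c
  | TFun f ts => TFun f (fun i => tsubst s (ts i))
  end.

(* The substitution s carried under a binder: the bound variable is fixed, and
   the free variables of the substituted terms are shifted past it. *)
Definition subst_up (S : signature) m n (s : 'I_m -> term S n)
    : 'I_m.+1 -> term S n.+1 :=
  ord_cons (TVar ord0) (fun i => tsubst (fun j => TVar (lift ord0 j)) (s i)).

Fixpoint fsubst (S : signature) m (phi : formula S m)
    : forall n, ('I_m -> term S n) -> formula S n :=
  match phi in formula _ m return forall n, ('I_m -> term S n) -> formula S n
  with
  | FDist _ t u => fun _ s => FDist (tsubst s t) (tsubst s u)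
  | FPred _ P ts => fun _ s => FPred P (fun i => tsubst s (ts i))
  | FConst _ q => fun _ _ => FConst q
  | FImp _ psi theta => fun _ s => FImp (fsubst psi s) (fsubst theta s)
  | FSupx _ psi => fun _ s => FSupx (fsubst psi (subst_up s))
  | FSupn _ psi => fun _ s => FSupn (fun k => fsubst (psi k) s)
  end.

(* The sup metric on M^n (equal to 0 for n = 0). *)
Definition sup_mdist (R : realType) (M : metricType R) n (a b : 'I_n -> M) : R :=
  \big[Num.max/0]_(i < n) mdist (a i) (b i).

Record structure (R : realType) (S : signature) : Type := Structure {
  carrier :> metricType R;
  carrier_inhabited : inhabited carrier;
  mdist_le1 : forall a b : carrier, mdist a b <= 1;
  finterp : forall f : fsym S, ('I_(farity f) -> carrier) -> carrier;
  pinterp : forall P : psym S, ('I_(parity P) -> carrier) -> R;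
  cinterp : csym S -> carrier;
  pinterp_itv : forall (P : psym S) a, 0 <= pinterp (P := P) a <= 1;
  finterp_mod : forall (f : fsym S) (e : rat_oo) a b,
    sup_mdist a b < ratr (sval (fmod f e)) ->
    mdist (finterp (f := f) a) (finterp (f := f) b) <= ratr (sval e);
  pinterp_mod : forall (P : psym S) (e : rat_oo) a b,
    sup_mdist a b < ratr (sval (pmod P e)) ->
    `|pinterp (P := P) a - pinterp (P := P) b| <= ratr (sval e) }.

Arguments finterp {R S} s f _.
Arguments pinterp {R S} s P _.
Arguments cinterp {R S} s _.

Fixpoint term_val (R : realType) (S : signature) (M : structure R S) n
    (v : 'I_n -> M) (t : term S n) : M :=
  match t with
  | TVar i => v i
  | TConst c => cinterp M c
  | TFun f ts => finterp M f (fun i => term_val v (ts i))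
  end.

Fixpoint formula_val (R : realType) (S : signature) (M : structure R S) n
    (phi : formula S n) : ('I_n -> M) -> R :=
  match phi in formula _ n return ('I_n -> M) -> R with
  | FDist _ t u => fun v => mdist (term_val v t) (term_val v u)
  | FPred _ P ts => fun v => pinterp M P (fun i => term_val v (ts i))
  | FConst _ q => fun _ => ratr (sval q)
  | FImp _ psi theta => fun v =>
      Num.min (1 - formula_val psi v + formula_val theta v) 1
  | FSupx _ psi => fun v =>
      sup (range (fun a : M => formula_val psi (ord_cons a v)))
  | FSupn _ psi => fun v => sup (range (fun k : nat => formula_val (psi k) v))
  end.

Definition satisfies (R : realType) (S : signature) (M : structure R S) n
    (phi : formula S n) (v : 'I_n -> M) : Prop :=
  formula_val phi v = 1.

Definition is_model (R : realType) (S : signature) (M : structure R S)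
    (T : set (sentence S)) : Prop :=
  forall phi v, T phi -> satisfies (M := M) phi v.

(* A set of formulas is given as the family of its members in each scope, L n
   being those with free variables among 'I_n.  Since substitutions go between
   scopes, fragment_subst also closes L under renaming and adding dummy
   variables.  Closure under subformulas cannot be dropped from the omitting
   types theorem: the sentence sup_x inf_k P_k(x), with inf_k P_k standing for
   ~ sup_k ~ P_k, forces {P_k(x) : k} to be realized in discrete {0,1}-valued
   structures, while finitary formulas built over that sentence as a black box
   need not isolate this type. *)
Record fragment (S : signature) (L : forall n, set (formula S n)) : Prop :=
  Fragment {
  fragment_dist : forall n (t u : term S n), L n (FDist t u);
  fragment_pred : forall n P (ts : 'I_(parity P) -> term S n), L n (FPred P ts);
  fragment_const : forall n q, L n (FConst q);
  fragment_imp : forall n (phi psi : formula S n),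
    L n phi -> L n psi -> L n (FImp phi psi);
  fragment_not : forall n (phi : formula S n), L n phi -> L n (FNot phi);
  fragment_supx : forall n (phi : formula S n.+1), L n.+1 phi -> L n (FSupx phi);
  fragment_subst : forall m n (phi : formula S m) (s : 'I_m -> term S n),
    L m phi -> L n (fsubst phi s);
  fragment_sub_imp : forall n (phi psi : formula S n),
    L n (FImp phi psi) -> L n phi /\ L n psi;
  fragment_sub_supx : forall n (phi : formula S n.+1),
    L n (FSupx phi) -> L n.+1 phi;
  fragment_sub_supn : forall n (phi : nat -> formula S n),
    L n (FSupn phi) -> forall k, L n (phi k) }.

Definition realizes (R : realType) (S : signature) (M : structure R S) n
    (Sigma : set (formula S n)) (a : 'I_n -> M) : Prop :=
  forall phi, Sigma phi -> satisfies phi a.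

Definition omits (R : realType) (S : signature) (M : structure R S) n
    (Sigma : set (formula S n)) : Prop :=
  forall a : 'I_n -> M, ~ realizes Sigma a.

Definition is_type (R : realType) (S : signature)
    (L : forall n, set (formula S n)) (T : set (sentence S)) n
    (Sigma : set (formula S n)) : Prop :=
  Sigma `<=` L n /\
  exists (M : structure R S) (a : 'I_n -> M), is_model M T /\ realizes Sigma a.

Definition principal (R : realType) (S : signature)
    (L : forall n, set (formula S n)) (T : set (sentence S)) n
    (Sigma : set (formula S n)) : Prop :=
  exists (m : nat) (phi : formula S m) (t : 'I_n -> term S m) (r : rat_oo),
    [/\ L m phi,
        exists (M : structure R S) (b : 'I_m -> M),
          is_model M T /\ satisfies phi b &
        forall (M : structure R S) (b : 'I_m -> M),
          is_model M T -> ratr (sval r) <= formula_val phi b ->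
          realizes Sigma (fun i => term_val b (t i))].

(* Main.v *)
(* A condition is a nonempty set of worlds (models of T with an interpretation
   of the variables x_0, x_1, ...) of the form phi > r, phi in L.  A generic
   decreasing sequence of conditions decides, for each supremum in L and each
   rational r, whether the supremum is <= r or some named instance exceeds r;
   non-principality makes it force, for each n and each tuple t of terms, some
   sigma(t) < q < 1 with sigma in Sigma_n.  Choosing a world in each condition
   and an ultrafilter U on nat, the terms modulo lim_U d = 0 form a structure in
   which every formula of L takes the U-limit of its values in the worlds. *)

Require Import Defs.
From HB Require Import structures.
From mathcomp Require Import all_boot all_order all_algebra.
From mathcomp Require Import all_classical all_reals.
From mathcomp Require Import topology normedtype metric_structure lra.

Set Implicit Arguments.
Unset Strict Implicit.
Unset Printing Implicit Defensive.

Import Order.TTheory GRing.Theory Num.Theory.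
Import numFieldNormedType.Exports.

Local Open Scope classical_set_scope.
Local Open Scope ring_scope.

(** * Generic sequences for countably many dense requirements *)

(* Predicates X -> Prop are used instead of set X because X will be a type of
   structures, too large for the universe of classical sets. *)
Lemma generic_sequence (X : Type) (C : (X -> Prop) -> Prop) (I : countType)
    (D : I -> (X -> Prop) -> Prop) (A0 : X -> Prop) :
  (forall A, C A -> exists x, A x) -> C A0 ->
  (forall i A, C A -> exists B, [/\ C B, forall x, B x -> A x & D i B]) ->
  exists w : nat -> X,
    forall i, exists2 B, D i B & \forall n \near \oo, B (w n).
Proof.
move=> C_nonempty CA0 dense.
(* Stage [n] treats the requirement with code [n], if there is one. The sets only shrink afterwards,
   so all later points stay inside the set that met it. *)
have next (nA : nat * {A | C A}) : {B : {A | C A} |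
    (forall x, sval B x -> sval nA.2 x) /\
    forall i, unpickle nA.1 = Some i -> D i (sval B)}.
  apply: cid; case: nA => n [A CA] /=; case: (unpickle n) => [i|]; last first.
    by exists (exist _ A CA); split.
  have [B [CB BA DB]] := dense i A CA.
  by exists (exist _ B CB); split=> // _ [<-].
pose O := fix O n := if n is m.+1 then sval (next (m, O m))
                     else exist _ A0 CA0 : {A | C A}.
have decrO n x : sval (O n.+1) x -> sval (O n) x.
  by have [+ _] := svalP (next (n, O n)); apply.
have leO m n x : (m <= n)%N -> sval (O n) x -> sval (O m) x.
  move=> /subnK <-; elim: (n - m)%N => [//|p IH]; rewrite addSn => /decrO.
  exact: IH.
have [w wO] : {w | forall n, sval (O n) (w n)}.
  exists (fun n => sval (cid (C_nonempty _ (svalP (O n))))) => n.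
  by case: cid.
exists w => i; exists (sval (O (pickle i).+1)).
  by have [_] := svalP (next (pickle i, O (pickle i))); apply; rewrite pickleK.
by exists (pickle i).+1 => // n /= /leO; apply; exact: wO.
Qed.

(** * Limits of bounded sequences along an ultrafilter *)

Section UltraLimit.
Variables (R : realType) (U : set_system nat).
Hypothesis ultraU : UltraFilter U.
Implicit Types F G : nat -> R.

Definition ulim F : R := lim (F @ U).

Let pfU : ProperFilter U := @ultra_proper _ _ ultraU.

(** If a proper filter [G] above the image contains [B], the complement of [B] cannot be in the
    image, so the ultrafilter [U] contains the preimage of [B]. *)
Lemma fmap_ultra (Y : Type) (f : nat -> Y) : UltraFilter (f @ U).
Proof.
split=> [|G properG subG]; first exact: fmap_proper_filter.
rewrite eqEsubset; split=> // B GB.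
have [//|UfB] := in_ultra_setVsetC (f @^-1` B) ultraU.
have /filter_ex[x []//] : G (B `&` ~` B) by apply: filterI => //; exact: subG.
Qed.

(** By compactness of $[0,1]$ the image ultrafilter converges. The bounds on [F] matter: for a
    divergent sequence [lim] is only a default value. *)
Lemma cvg_ulim F : (forall x, 0 <= F x <= 1) -> F @ U --> ulim F.
Proof.
move=> F01.
have := @segment_compact R 0 1; rewrite compact_ultra.
move=> /(_ (F @ U) (fmap_ultra F))[].
  by apply: (@filterE _ U) => x; rewrite /= in_itv /=; exact: F01.
by move=> y [_ Fy]; apply/cvg_ex; exists y.
Qed.

Lemma ulim_eq F (l : R) : F @ U --> l -> ulim F = l.
Proof. by move=> Fl; apply: cvg_lim. Qed.

Lemma ulim_near_le F (r : R) : (forall x, 0 <= F x <= 1) ->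
  (\forall x \near U, F x <= r) -> ulim F <= r.
Proof. by move=> F01 rF; apply: (ler_cvg_to (cvg_ulim F01) (cvg_cst r)). Qed.

Lemma ulim_near_ge F (r : R) : (forall x, 0 <= F x <= 1) ->
  (\forall x \near U, r <= F x) -> r <= ulim F.
Proof. by move=> F01 rF; apply: (ler_cvg_to (cvg_cst r) (cvg_ulim F01)). Qed.

Lemma ulim_itv F : (forall x, 0 <= F x <= 1) -> 0 <= ulim F <= 1.
Proof.
move=> F01; apply/andP; split;
  [apply: ulim_near_ge | apply: ulim_near_le] => //;
  by apply: filterE => x; case/andP: (F01 x).
Qed.

Lemma ulim_le F G : (forall x, 0 <= F x <= 1) -> (forall x, 0 <= G x <= 1) ->
  (forall x, F x <= G x) -> ulim F <= ulim G.
Proof.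
move=> F01 G01 FG; apply: (ler_cvg_to (cvg_ulim F01) (cvg_ulim G01)).
exact: filterE.
Qed.

Lemma ulim_dist_le F G (e : R) :
  (forall x, 0 <= F x <= 1) -> (forall x, 0 <= G x <= 1) ->
  (\forall x \near U, `|F x - G x| <= e) -> `|ulim F - ulim G| <= e.
Proof.
move=> F01 G01 FG; apply: ler_cvg_to (cvg_cst e) FG.
by apply: cvg_norm; apply: cvgB; exact: cvg_ulim.
Qed.

Lemma ulim_leD F G H : (forall x, 0 <= F x <= 1) -> (forall x, 0 <= G x <= 1) ->
  (forall x, 0 <= H x <= 1) ->
  (forall x, F x <= G x + H x) -> ulim F <= ulim G + ulim H.
Proof.
move=> F01 G01 H01 FGH; apply: (ler_cvg_to (cvg_ulim F01)).
  by apply: cvgD; exact: cvg_ulim.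
exact: filterE.
Qed.

(** Truncated implication is a continuous function of its two arguments. *)
Lemma ulim_imp F G : (forall x, 0 <= F x <= 1) -> (forall x, 0 <= G x <= 1) ->
  ulim (fun x => Num.min (1 - F x + G x) 1) = Num.min (1 - ulim F + ulim G) 1.
Proof.
move=> F01 G01; apply: ulim_eq.
apply: (@cvg_comp _ _ _ (fun x => 1 - F x + G x) (fun y => Num.min y 1)).
  apply: cvgD; last exact: cvg_ulim.
  by apply: cvgB; [exact: cvg_cst | exact: cvg_ulim].
by apply: (@continuous_min R R id (cst 1)); [exact: cvg_id | exact: cvg_cst].
Qed.

End UltraLimit.

(** * The metric space of a pseudometric *)

Section MetricQuotient.
Variables (R : realType) (X : Type) (D : X -> X -> R).
Hypothesis D_refl : forall x, D x x = 0.
Hypothesis D_sym : forall x y, D x y = D y x.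
Hypothesis D_triangle : forall y x z, D x z <= D x y + D y z.

(* The class of x is coded by the function D x, which determines it. *)
Definition mquot := {g : X -> R | exists x, g = D x}.
HB.instance Definition _ := gen_eqMixin mquot.
HB.instance Definition _ := gen_choiceMixin mquot.

Definition mpi (x : X) : mquot := exist _ (D x) (ex_intro _ x erefl).
Definition mrepr (g : mquot) : X := sval (cid (svalP g)).

Lemma mreprK g : mpi (mrepr g) = g.
Proof.
by case: g => g ex; apply: eq_exist; rewrite /mrepr; case: cid => /= x ->.
Qed.

(** The triangle inequality through [x] and through [y] makes the functions [D x] and [D y]
    equal. *)
Lemma mpi_eq x y : D x y = 0 -> mpi x = mpi y.
Proof.
move=> Dxy; apply: eq_exist; apply/funext => z; apply/eqP; rewrite eq_le.
have := D_triangle y x z; have := D_triangle x y z.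
by rewrite (D_sym y x) Dxy !add0r => -> ->.
Qed.

Let mD g h := D (mrepr g) (mrepr h).

Let mD_pos g h : mD g h = 0 -> g = h.
Proof. by move=> /mpi_eq; rewrite !mreprK. Qed.

HB.instance Definition _ := @isMetric.Build R mquot mD
  (fun=> D_refl _) mD_pos (fun _ _ => D_sym _ _)
  (fun _ _ _ => D_triangle _ _ _).

(** A class stores the whole function [D x], and by [mreprK] the chosen representative has that same
    function. *)
Lemma D_mrepr x y : D (mrepr (mpi x)) y = D x y.
Proof. by rewrite -[LHS]/(sval (mpi _) y) mreprK. Qed.

Lemma mdist_mpi x y : mdist (mpi x) (mpi y) = D x y.
Proof. by rewrite -[LHS]/(D _ _) D_mrepr D_sym D_mrepr D_sym. Qed.

Lemma metric_quotient : exists (M : metricType R) (pi : X -> M) (rho : M -> X),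
  cancel rho pi /\ forall x y, mdist (pi x) (pi y) = D x y.
Proof.
by exists mquot, mpi, mrepr; split; [exact: mreprK | exact: mdist_mpi].
Qed.

End MetricQuotient.

(** * Substitution and the range of truth values *)

Section Semantics.
Variables (R : realType) (S : signature) (M : structure R S).

Lemma term_val_tsubst m n (s : 'I_m -> term S n) (v : 'I_n -> M) t :
  term_val v (tsubst s t) = term_val (fun i => term_val v (s i)) t.
Proof.
elim: t => //= f ts IH; congr finterp.
by apply/funext => i; exact: IH.
Qed.

Lemma term_val_subst_up m n (s : 'I_m -> term S n) (v : 'I_n -> M) (a : M) i :
  term_val (ord_cons a v) (subst_up s i) =
  ord_cons a (fun j => term_val v (s j)) i.
Proof.
rewrite /subst_up /ord_cons; case: unliftP => [j _|_] /=; last first.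
  by rewrite unlift_none.
rewrite term_val_tsubst /=; congr term_val; apply/funext => l /=.
by rewrite liftK.
Qed.

(** The induction keeps [s] and [v] general, since under a binder they become [subst_up s] and
    [ord_cons a v]. *)
Lemma formula_val_fsubst m (phi : formula S m) : forall n (s : 'I_m -> term S n)
  (v : 'I_n -> M),
  formula_val (fsubst phi s) v = formula_val phi (fun i => term_val v (s i)).
Proof.
elim: phi => {m} /=.
- by move=> m t u n s v; rewrite !term_val_tsubst.
- move=> m P ts n s v; congr pinterp; apply/funext => i.
  by rewrite term_val_tsubst.
- by [].
- by move=> m psi IH1 theta IH2 n s v; rewrite IH1 IH2.
- move=> m psi IH n s v; congr (sup _); apply: eq_imagel => a _.
  rewrite IH; congr (formula_val _ _); apply: funext => i.
  exact: term_val_subst_up.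
- by move=> m psi IH n s v; congr (sup _); apply: eq_imagel => k _.
Qed.

Lemma range_sup_itv I (F : I -> R) : inhabited I -> (forall i, 0 <= F i <= 1) ->
  0 <= sup (range F) <= 1.
Proof.
move=> [i] F01; apply/andP; split.
  apply: (le_trans (andP (F01 i)).1); apply: ub_le_sup; last by exists i.
  by exists 1 => _ [j _ <-]; case/andP: (F01 j).
by apply: ge_sup; [exists (F i), i | move=> _ [j _ <-]; case/andP: (F01 j)].
Qed.

Lemma formula_val_itv n (phi : formula S n) (v : 'I_n -> M) :
  0 <= formula_val phi v <= 1.
Proof.
elim: phi v => {n} /=.
- by move=> n t u v; rewrite mdist_ge0 mdist_le1.
- by move=> n P ts v; exact: pinterp_itv.
- move=> n [q /= /andP[q0 q1]] _.
  by rewrite ler0q q0 /= -(rmorph1 (@ratr R)) ler_rat.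
- move=> n psi IH1 theta IH2 v.
  rewrite ge_min lexx orbT le_min ler01 andbT.
  by have := IH1 v; have := IH2 v; lra.
- by move=> n psi IH v; apply: range_sup_itv => //; exact: carrier_inhabited.
- by move=> n psi IH v; apply: range_sup_itv.
Qed.

End Semantics.

(** * Definable connectives and rational constants *)

Section Formulas.
Variables (S : signature) (L : forall n, set (formula S n)).
Hypothesis fragL : fragment L.

(** In Łukasiewicz logic $(a \to b) \to b$ has value $\max(a,b)$; the minimum is the negation of the
    maximum of the negations. *)
Definition FMin n (phi psi : formula S n) : formula S n :=
  FNot (FImp (FImp (FNot phi) (FNot psi)) (FNot psi)).

(* 0 outside of [0, 1]. *)
Definition to_rat_cc (q : rat) : rat_cc := insubd (Sub 0 isT : rat_cc) q.

Lemma fragment_min n (phi psi : formula S n) :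
  L phi -> L psi -> L (FMin phi psi).
Proof.
move=> Lphi Lpsi; apply: (fragment_not fragL).
by do ![apply: (fragment_not fragL) | apply: (fragment_imp fragL)].
Qed.

Section Values.
Variables (R : realType) (M : structure R S) (n : nat) (v : 'I_n -> M).

Lemma formula_val_imp (phi psi : formula S n) :
  formula_val (FImp phi psi) v =
  Num.min (1 - formula_val phi v + formula_val psi v) 1.
Proof. by []. Qed.

Lemma formula_val_not (phi : formula S n) :
  formula_val (FNot phi) v = 1 - formula_val phi v.
Proof.
rewrite /= raddf0 addr0 min_l //.
by have := formula_val_itv phi v; lra.
Qed.

Lemma formula_val_min (phi psi : formula S n) :
  formula_val (FMin phi psi) v =
  Num.min (formula_val phi v) (formula_val psi v).
Proof.
rewrite formula_val_not (formula_val_imp (FImp _ _)).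
rewrite (formula_val_imp (FNot phi)).
rewrite !formula_val_not.
have := formula_val_itv phi v; have := formula_val_itv psi v.
by rewrite /Num.min; do !case: ifPn; lra.
Qed.

End Values.
End Formulas.

(** * Terms as names, worlds, and basic open sets of worlds *)

(* Elements of the model are named by terms whose variables range over nat: a
   term over n uses the variables below n. *)
Definition nterm (S : signature) := {n & term S n}.

Definition nvar (S : signature) (n : nat) : nterm S :=
  existT _ n.+1 (TVar ord_max).

Section Worlds.
Variables (R : realType) (S : signature) (T : set (sentence S)).

Record world : Type := World {
  wmodel :> structure R S;
  wmodelP : is_model wmodel T;
  wval : nat -> wmodel }.

Definition wprefix (w : world) n (i : 'I_n) : w := wval w i.

Definition nterm_val (w : world) (t : nterm S) : w :=
  term_val (wprefix w (n := tag t)) (tagged t).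

(** One tuple [s'] serves all worlds, because variable [i] denotes [wval w i] in every scope.
    Allowing every [N] above a bound lets the common scope also match that of a given formula. *)
Lemma nterm_common k (s : 'I_k -> nterm S) :
  exists N0, forall N, (N0 <= N)%N -> exists s' : 'I_k -> term S N,
    forall w i, term_val (wprefix w (n := N)) (s' i) = nterm_val w (s i).
Proof.
exists (\max_i tag (s i)) => N leN.
have le_tag i : (tag (s i) <= N)%N by apply: leq_trans leN; exact: leq_bigmax.
exists (fun i =>
  tsubst (fun j => TVar (widen_ord (le_tag i) j)) (tagged (s i))).
by move=> w i; rewrite term_val_tsubst.
Qed.

Lemma extend_valuation (M : structure R S) n (b : 'I_n -> M) :
  exists v : nat -> M, forall i : 'I_n, v i = b i.
Proof.
have [c] := carrier_inhabited M.
exists (fun j => if insub j is Some i then b i else c) => i.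
by rewrite valK.
Qed.

Variable L : forall n, set (formula S n).
Hypothesis fragL : fragment L.

Definition basic_open (A : world -> Prop) : Prop :=
  exists (N : nat) (phi : formula S N) (r : rat), [/\ L phi, 0 <= r &
    forall w, A w <-> ratr r < formula_val phi (wprefix w (n := N))].

Lemma basic_open_gt m (phi : formula S m) (s : 'I_m -> nterm S) (r : rat) :
  L phi -> 0 <= r ->
  basic_open (fun w => ratr r < formula_val phi (nterm_val w \o s)).
Proof.
move=> Lphi r0; have [N /(_ N (leqnn N))[s' s'E]] := nterm_common s.
exists N, (fsubst phi s'), r; split=> //; first exact: (fragment_subst fragL).
move=> w; rewrite formula_val_fsubst.
rewrite (_ : (fun i => _) = nterm_val w \o s) //.
by apply/funext => i; exact: s'E.
Qed.

Lemma basic_open_lt m (phi : formula S m) (s : 'I_m -> nterm S) (q : rat) :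
  L phi -> q <= 1 ->
  basic_open (fun w => formula_val phi (nterm_val w \o s) < ratr q).
Proof.
move=> Lphi q1.
(* An upper bound [q] on [phi] is the lower bound [1 - q] on its negation. *)
have [||N [psi [r [Lpsi r0 rE]]]] := @basic_open_gt _ (FNot phi) s (1 - q).
- exact: (fragment_not fragL).
- by rewrite subr_ge0.
exists N, psi, r; split=> // w; rewrite -rE.
by rewrite formula_val_not raddfB /= rmorph1; split; lra.
Qed.

Lemma fragment_widen m n (phi : formula S m) : (m <= n)%N -> L phi ->
  exists2 psi : formula S n, L psi & forall w : world,
    formula_val psi (wprefix w (n := n)) = formula_val phi (wprefix w (n := m)).
Proof.
move=> lemn Lphi; exists (fsubst phi (fun i => TVar (widen_ord lemn i))).
  exact: (fragment_subst fragL).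
by move=> w; rewrite formula_val_fsubst.
Qed.

(** For $s \le r$ and $c = 1 - r + s$, the formula $c \to \psi$ has value $\min(r - s + \psi, 1)$,
    which lifts the threshold of $\psi$ from $s$ to $r$. Its minimum with $\phi$ then expresses both
    conditions at once. *)
Lemma basic_openI (A B : world -> Prop) w0 :
  basic_open A -> basic_open B -> A w0 -> B w0 ->
  basic_open (fun w => A w /\ B w).
Proof.
move=> [m [phi [r [Lphi r0 AE]]]] [n [psi [s [Lpsi s0 BE]]]] Aw0 Bw0.
wlog les : A B m n phi psi r s Lphi Lpsi r0 s0 AE BE Aw0 Bw0 / s <= r.
  move=> wl; have [|/ltW rs] := leP s r.
    by move=> sr; apply: (wl A B m n phi psi r s).
  have [N [chi [q [Lchi q0 chiE]]]] :=
    wl B A n m psi phi s r Lpsi Lphi s0 r0 BE AE Bw0 Aw0 rs.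
  by exists N, chi, q; split=> // w; rewrite -chiE; split=> -[].
have [phi' Lphi' phi'E] := fragment_widen (leq_maxl m n) Lphi.
have [psi' Lpsi' psi'E] := fragment_widen (leq_maxr m n) Lpsi.
have ratr1 : ratr 1 = 1 :> R by rewrite rmorph1.
(* The common world gives $r < 1$, so that truncation at 1 stays above the threshold; it also puts
   [c] in $[0,1]$. *)
have r1 : r < 1.
  rewrite -(ltr_rat R) ratr1; apply: (lt_le_trans ((AE w0).1 Aw0)).
  by case/andP: (formula_val_itv phi (wprefix w0 (n := m))).
pose c := to_rat_cc (1 - r + s).
have cE : sval c = 1 - r + s.
  by rewrite /c /to_rat_cc -[sval _]/(val _) val_insubd ifT //; lra.
exists (maxn m n), (FMin phi' (FImp (FConst c) psi')), r; split=> //.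
  apply: fragment_min => //; apply: (fragment_imp fragL) => //.
  exact: (fragment_const fragL).
move=> w; rewrite AE BE formula_val_min formula_val_imp phi'E psi'E /= cE.
rewrite !raddfD /= raddfN /= ratr1.
have : ratr r < 1 :> R by rewrite -ratr1 ltr_rat.
move: (formula_val phi _) (formula_val psi _) (ratr r) (ratr s) => a b x y x1.
rewrite !lt_min; split; first by move=> []; lra.
by move=> ?; split; lra.
Qed.

(** * Density of the requirements *)

Definition condition (A : world -> Prop) : Prop :=
  basic_open A /\ exists w, A w.

Lemma condition_and (A B : world -> Prop) w :
  basic_open A -> basic_open B -> A w -> B w -> condition (fun w => A w /\ B w).
Proof.
by move=> oA oB Aw Bw; split; [exact: (basic_openI oA oB Aw Bw) | exists w].
Qed.

Lemma wprefix_change (w : world) n (a : w) (j : nat) : (n <= j)%N ->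
  wprefix (World (@wmodelP w) (fun i => if i == j then a else wval w i))
    (n := n) =
  wprefix w (n := n).
Proof.
move=> nj; apply/funext => i; rewrite /wprefix /= ifF //.
by apply: ltn_eqF; exact: leq_trans nj.
Qed.

Definition decides_supx N (psi : formula S N.+1) (r : rat)
    (B : world -> Prop) :=
  (forall w, B w -> formula_val (FSupx psi) (wprefix w (n := N)) <= ratr r) \/
  exists x : nterm S, forall w, B w ->
    ratr r < formula_val psi (ord_cons (nterm_val w x) (wprefix w (n := N))).

(** If the bound [r] fails at some world of [A], an element there witnesses the failure. Name it by
    a fresh variable and keep the worlds where this name is a witness. *)
Lemma dense_supx N (psi : formula S N.+1) (r : rat) A :
  L psi -> 0 <= r -> condition A ->
  exists B, [/\ condition B, forall w, B w -> A w & decides_supx psi r B].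
Proof.
move=> Lpsi r0 [oA neA].
have [le_r|] := pselect (forall w, A w ->
    formula_val (FSupx psi) (wprefix w (n := N)) <= ratr r).
  by exists A; split=> //; left.
move=> /existsNP[w /not_implyP[Aw /negP]]; rewrite -ltNge /=.
move=> /sup_gt[|_ [a _ <-] ra].
  by have [a] := carrier_inhabited w; eexists; exists a.
have [n [phi [q [Lphi q0 AE]]]] := oA.
(* [x_j] is outside the scopes of [FSupx psi] and of the formula defining [A], so setting it to [a]
   keeps the world in [A]. *)
pose j := maxn N n.
pose w' := World (@wmodelP w) (fun i => if i == j then a else wval w i).
pose s i := ord_cons (nvar S j) (fun i : 'I_N => nvar S i) i.
have sE v : nterm_val v \o s =
    ord_cons (nterm_val v (nvar S j)) (wprefix v (n := N)).
  apply/funext => i; rewrite /= /s /ord_cons; case: unliftP => //= l _.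
have oB := basic_open_gt s Lpsi r0.
exists (fun w => A w /\ ratr r < formula_val psi (nterm_val w \o s)); split.
- apply: (@condition_and _ _ w') => //.
    by apply/AE; rewrite wprefix_change ?leq_maxr //; apply/AE.
  by rewrite sE wprefix_change ?leq_maxl // /nterm_val /= /wprefix /= eqxx.
- by move=> v [].
- by right; exists (nvar S j) => v []; rewrite sE.
Qed.

Definition decides_supn N (psi : nat -> formula S N) (r : rat)
    (B : world -> Prop) :=
  (forall w, B w -> formula_val (FSupn psi) (wprefix w (n := N)) <= ratr r) \/
  exists j, forall w, B w -> ratr r < formula_val (psi j) (wprefix w (n := N)).

(** As for [dense_supx], but the witness is an index [j], so no new name has to be introduced. *)
Lemma dense_supn N (psi : nat -> formula S N) (r : rat) A :
  (forall j, L (psi j)) -> 0 <= r -> condition A ->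
  exists B, [/\ condition B, forall w, B w -> A w & decides_supn psi r B].
Proof.
move=> Lpsi r0 [oA neA].
have [le_r|] := pselect (forall w, A w ->
    formula_val (FSupn psi) (wprefix w (n := N)) <= ratr r).
  by exists A; split=> //; left.
move=> /existsNP[w /not_implyP[Aw /negP]]; rewrite -ltNge /=.
move=> /sup_gt[|_ [j _ <-] rj].
  by eexists; exists 0%N.
exists (fun w => A w /\ ratr r < formula_val (psi j) (wprefix w (n := N))).
split.
- by apply: (@condition_and _ _ w) => //; exists N, (psi j), r.
- by move=> v [].
- by right; exists j => v [].
Qed.

(** Here non-principality is used: if all of [Sigma] had value 1 at [t] in every world of [A], the
    formula defining [A] would yield one making [Sigma] principal. *)
Lemma dense_omit n (Sigma : set (formula S n)) (t : 'I_n -> nterm S) A :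
  Sigma `<=` L (n:=n) -> ~ principal R L T Sigma -> condition A ->
  exists B, [/\ condition B, forall w, B w -> A w &
    exists sigma (q : rat), [/\ Sigma sigma, q < 1 &
      forall w, B w -> formula_val sigma (nterm_val w \o t) < ratr q]].
Proof.
move=> SigmaL nonprincipal [oA [w0 Aw0]].
have [w [sigma [Aw Ssigma sigma1]]] : exists w sigma,
    [/\ A w, Sigma sigma & formula_val sigma (nterm_val w \o t) < 1].
  apply: contra_notP nonprincipal => /forallNP no_w.
  have [N [phi [r [Lphi r0 AE]]]] := oA.
  have /rat_in_itvoo[q] := (AE w0).1 Aw0.
  rewrite in_itv /= ltr_rat => /andP[rq qphi].
  have [N0 /(_ _ (leq_maxr N N0))[t' t'E]] := nterm_common t.
  have [phi' Lphi' phi'E] := fragment_widen (leq_maxl N N0) Lphi.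
  have q1 : q < 1.
    rewrite -(ltr_rat R) rmorph1; apply: (lt_le_trans qphi).
    by case/andP: (formula_val_itv phi (wprefix w0 (n := N))).
  (* The isolating formula is $q \to \phi$. It has value 1 at [w0], where $\phi > q$, and a value of
     at least $1 - (q-r)/2$ forces $\phi \ge (q+r)/2 > r$, which is membership in [A]. *)
  have e01 : 0 < 1 - (q - r) / 2 < 1 by lra.
  have cE : sval (to_rat_cc q) = q.
    by rewrite /to_rat_cc -[sval _]/(val _) val_insubd ifT //; lra.
  exists _, (FImp (FConst (to_rat_cc q)) phi'), t',
    (exist (fun q : rat => is_true (0 < q < 1)) _ e01); split.
  - apply: (fragment_imp fragL) => //; exact: (fragment_const fragL).
  - exists w0, (wprefix w0 (n := _)); split; first exact: (@wmodelP w0).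
    by rewrite /satisfies formula_val_imp /= cE phi'E min_r //; lra.
  (* Any model of [T] with a tuple becomes a world once the remaining variables get arbitrary
     values. *)
  - move=> M b MT; have [v vb] := extend_valuation b.
    pose w := World MT v.
    have -> : b = wprefix w (n := _) by apply/funext => i; rewrite -vb.
    rewrite formula_val_imp /= cE (phi'E w) => le_e sigma Ssigma.
    have Aw : A w.
      apply/AE; move: le_e; rewrite raddfB /= rmorph1 rmorphM raddfB /=.
      rewrite fmorphV /= ratr_nat le_min => /andP[+ _].
      have : ratr r < ratr q :> R by rewrite ltr_rat.
      lra.
    rewrite /satisfies (_ : (fun i => _) = nterm_val w \o t); last first.
      by apply/funext => i; exact: t'E.
    apply/eqP; rewrite eq_le.
    case/andP: (formula_val_itv sigma (nterm_val w \o t)) => _ ->.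
    rewrite /= leNgt; apply/negP => lt1.
    by apply: (no_w w); exists sigma.
(* A rational gap below 1 is kept, since a mere inequality [< 1] could be lost in the limit. *)
have /rat_in_itvoo[q] := sigma1; rewrite in_itv /= => /andP[sq q1].
have {}q1 : q < 1 by rewrite -(ltr_rat R) rmorph1.
exists (fun w => A w /\ formula_val sigma (nterm_val w \o t) < ratr q); split.
- apply: (@condition_and _ _ w) => //.
  by apply: basic_open_lt => //; [exact: SigmaL | exact: ltW].
- by move=> v [].
- by exists sigma, q; split=> // v [].
Qed.

End Worlds.

(** * The limit structure on terms *)

Lemma mdist_itv (R : realType) (S : signature) (M : structure R S) (a b : M) :
  0 <= mdist a b <= 1.
Proof. by rewrite mdist_ge0 mdist_le1. Qed.

Lemma sup_mdist_ltP (R : realType) (M : metricType R) n (a b : 'I_n -> M)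
    (r : R) : 0 < r ->
  sup_mdist a b < r <-> forall i, mdist (a i) (b i) < r.
Proof.
move=> r0; split=> [/bigmax_ltP[_ h] i|h]; first exact: h.
by apply/bigmax_ltP; split.
Qed.

(** Moduli of continuity only speak of rationals in $(0,1)$; these are small enough to force a
    distance to vanish. *)
Lemma ratr_small (R : realType) (x : R) :
  (forall e : rat_oo, x <= ratr (sval e)) -> x <= 0.
Proof.
move=> xe; rewrite leNgt; apply/negP => x0.
have /rat_in_itvoo[q] : 0 < Num.min x 1 by rewrite lt_min x0 ltr01.
rewrite in_itv /= ltr0q lt_min => /andP[q0 /andP[qx q1]].
have q01 : 0 < q < 1 by rewrite q0 -(ltr_rat R) rmorph1.
have := xe (exist (fun q : rat => is_true (0 < q < 1)) q q01).
by rewrite leNgt /= qx.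
Qed.

Section Henkin.
Variables (R : realType) (S : signature) (T : set (sentence S)).
Variables (w : nat -> world R T) (U : set_system nat).
Hypothesis ultraU : UltraFilter U.

Let pfU : ProperFilter U := @ultra_proper _ _ ultraU.

Definition ndist (x y : nterm S) : R :=
  ulim U (fun n => mdist (nterm_val (w n) x) (nterm_val (w n) y)).

Lemma ndist_refl x : ndist x x = 0.
Proof.
apply: ulim_eq; rewrite (_ : (fun n => _) = cst 0); first exact: cvg_cst.
by apply/funext => n; rewrite mdistxx.
Qed.

Lemma ndist_sym x y : ndist x y = ndist y x.
Proof. by congr ulim; apply/funext => n; rewrite metric_sym. Qed.

Lemma ndist_triangle y x z : ndist x z <= ndist x y + ndist y z.
Proof.
by apply: ulim_leD => n; rewrite ?mdist_itv //; exact: metric_triangle.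
Qed.

Variables (M : metricType R) (pi : nterm S -> M) (rho : M -> nterm S).
Hypothesis rhoK : cancel rho pi.
Hypothesis mdist_pi : forall x y, mdist (pi x) (pi y) = ndist x y.

Lemma pi_eq x y :
  (forall n, nterm_val (w n) x = nterm_val (w n) y) -> pi x = pi y.
Proof.
move=> xy; apply: mdist_positivity; rewrite mdist_pi -(ndist_refl y).
by congr ulim; apply/funext => n; rewrite xy.
Qed.

Lemma nterm_app (f : Defs.fsym S) (a : 'I_(farity f) -> nterm S) :
  exists x, forall v : world R T,
    nterm_val v x = finterp v f (fun i => nterm_val v (a i)).
Proof.
have [N /(_ N (leqnn N))[a' a'E]] := nterm_common R T a.
exists (existT _ N (TFun f a')) => v; rewrite /nterm_val /=.
by congr finterp; apply/funext => i; exact: a'E.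
Qed.

Definition napp f a : nterm S := sval (cid (nterm_app (f := f) a)).

Lemma nterm_val_app f a (v : world R T) :
  nterm_val v (napp (f := f) a) = finterp v f (fun i => nterm_val v (a i)).
Proof. by rewrite /napp; case: cid. Qed.

Definition npred (P : psym S) (a : 'I_(parity P) -> nterm S) : R :=
  ulim U (fun n => pinterp (w n) P (fun i => nterm_val (w n) (a i))).

Definition nconst (c : csym S) : nterm S := existT _ 0%N (TConst c).

(** A strict inequality between limits holds at [U]-almost all worlds, and a tuple has finitely many
    entries. This is why moduli survive the limit: their premise is strict and their conclusion is
    not. *)
Lemma near_sup_mdist k (a b : 'I_k -> nterm S) (r : R) : 0 < r ->
  (forall i, ndist (a i) (b i) < r) ->
  \forall n \near U, sup_mdist (fun i => nterm_val (w n) (a i))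
                               (fun i => nterm_val (w n) (b i)) < r.
Proof.
move=> r0 abr.
have near_all : \forall n \near U, forall i,
    mdist (nterm_val (w n) (a i)) (nterm_val (w n) (b i)) < r.
  apply: filter_forall => i; apply: (cvgr_lt (ndist (a i) (b i))) (abr i).
  by apply: cvg_ulim => n; exact: mdist_itv.
by apply: filterS near_all => n ?; apply/sup_mdist_ltP.
Qed.

Lemma ratr_oo_gt0 (e : rat_oo) : 0 < ratr (sval e) :> R.
Proof. by case: e => q /= /andP[q0 _]; rewrite ltr0q. Qed.

Lemma napp_mod (f : Defs.fsym S) (e : rat_oo) (a b : 'I_(farity f) -> nterm S) :
  (forall i, ndist (a i) (b i) < ratr (sval (Defs.fmod f e))) ->
  ndist (napp a) (napp b) <= ratr (sval e).
Proof.
move=> /(near_sup_mdist (ratr_oo_gt0 _)) ab.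
apply: ulim_near_le => [n|]; first exact: mdist_itv.
by apply: filterS ab => n ab; rewrite !nterm_val_app; exact: finterp_mod ab.
Qed.

Lemma npred_mod (P : psym S) (e : rat_oo) (a b : 'I_(parity P) -> nterm S) :
  (forall i, ndist (a i) (b i) < ratr (sval (pmod P e))) ->
  `|npred a - npred b| <= ratr (sval e).
Proof.
move=> /(near_sup_mdist (ratr_oo_gt0 _)) ab.
apply: ulim_dist_le => [n|n|]; [exact: pinterp_itv | exact: pinterp_itv |].
by apply: filterS ab => n ab; exact: pinterp_mod ab.
Qed.

Lemma npred_itv (P : psym S) (a : 'I_(parity P) -> nterm S) :
  0 <= npred a <= 1.
Proof. by apply: ulim_itv => n; exact: pinterp_itv. Qed.

Lemma mdist_rho (a b : M) : mdist a b = ndist (rho a) (rho b).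
Proof. by rewrite -mdist_pi !rhoK. Qed.

Lemma henkin_mdist_le1 (a b : M) : mdist a b <= 1.
Proof.
rewrite mdist_rho; apply: ulim_near_le => [n|]; first exact: mdist_itv.
by apply: filterE => n; exact: mdist_le1.
Qed.

Lemma henkin_finterp_mod (f : Defs.fsym S) (e : rat_oo)
    (a b : 'I_(farity f) -> M) :
  sup_mdist a b < ratr (sval (Defs.fmod f e)) ->
  mdist (pi (napp (rho \o a))) (pi (napp (rho \o b))) <= ratr (sval e).
Proof.
move=> /(sup_mdist_ltP _ _ (ratr_oo_gt0 _)) ab.
by rewrite mdist_pi; apply: napp_mod => i; rewrite -mdist_rho.
Qed.

Lemma henkin_pinterp_mod (P : psym S) (e : rat_oo) (a b : 'I_(parity P) -> M) :
  sup_mdist a b < ratr (sval (pmod P e)) ->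
  `|npred (rho \o a) - npred (rho \o b)| <= ratr (sval e).
Proof.
move=> /(sup_mdist_ltP _ _ (ratr_oo_gt0 _)) ab.
by apply: npred_mod => i; rewrite -mdist_rho.
Qed.

(** Symbols act on the representatives chosen by [rho]; independence of that choice is shown by
    [henkin_finterp] and [henkin_pinterp]. *)
Definition henkin : structure R S :=
  @Structure R S M (inhabits (pi (nvar S 0))) henkin_mdist_le1
    (fun f a => pi (napp (rho \o a))) (fun P a => npred (rho \o a))
    (fun c => pi (nconst c)) (fun P a => npred_itv (rho \o a))
    henkin_finterp_mod henkin_pinterp_mod.

Lemma ndist_rho_pi x : ndist x (rho (pi x)) = 0.
Proof. by rewrite -mdist_pi rhoK mdistxx. Qed.

(** Each [a i] is at distance 0 from its chosen representative, so the modulus brings the two values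
    within every [e]. *)
Lemma henkin_finterp f a : finterp henkin f (pi \o a) = pi (napp a).
Proof.
apply: mdist_positivity; apply/eqP; rewrite eq_le mdist_ge0 andbT.
apply: ratr_small => e; rewrite mdist_pi; apply: napp_mod => i /=.
by rewrite ndist_sym ndist_rho_pi ratr_oo_gt0.
Qed.

Lemma henkin_pinterp P a : pinterp henkin P (pi \o a) = npred a.
Proof.
apply/eqP; rewrite -subr_eq0 -normr_eq0 eq_le normr_ge0 andbT.
apply: ratr_small => e; apply: npred_mod => i /=.
by rewrite ndist_sym ndist_rho_pi ratr_oo_gt0.
Qed.

Lemma nterm_subst m (s : 'I_m -> nterm S) (t : term S m) :
  exists x, forall v : world R T, nterm_val v x = term_val (nterm_val v \o s) t.
Proof.
have [N /(_ N (leqnn N))[s' s'E]] := nterm_common R T s.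
exists (existT _ N (tsubst s' t)) => v.
rewrite /nterm_val /= term_val_tsubst; congr term_val.
by apply/funext => j; exact: s'E.
Qed.

(** Taking any [x] with the right values, rather than one specific substituted term, lets the
    induction use the names chosen by [napp]. *)
Lemma henkin_term_val m (t : term S m) (s : 'I_m -> nterm S) x :
  (forall v : world R T, nterm_val v x = term_val (nterm_val v \o s) t) ->
  term_val (M := henkin) (pi \o s) t = pi x.
Proof.
elim: t x => /=.
- by move=> i x xE; apply: pi_eq => n; rewrite xE.
- by move=> c x xE; apply: pi_eq => n; rewrite xE.
- move=> f ts IH x xE.
  have /choice[a aE] i := nterm_subst s (ts i).
  rewrite (_ : (fun i => _) = pi \o a); last first.
    by apply/funext => i; exact: IH.
  rewrite -[LHS]/(finterp henkin f (pi \o a)) henkin_finterp.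
  apply: pi_eq => n; rewrite nterm_val_app xE; congr finterp.
  by apply/funext => i; exact: aE.
Qed.

(** * Truth values in the limit structure *)

Variable L : forall n, set (formula S n).
Hypothesis fragL : fragment L.
Hypothesis supxU : forall N (psi : formula S N.+1) (r : rat),
  L (FSupx psi) -> 0 <= r ->
  exists2 B, decides_supx psi r B & \forall n \near U, B (w n).
Hypothesis supnU : forall N (psi : nat -> formula S N) (r : rat),
  L (FSupn psi) -> 0 <= r ->
  exists2 B, decides_supn psi r B & \forall n \near U, B (w n).

(** One inequality is monotonicity. If the other failed, a rational [r] strictly between the two
    sides would be decided: either the limit of [G] is at most [r], or some [F i] has limit at least
    [r], and both are absurd. *)
Lemma sup_ulim I (F : I -> nat -> R) (G : nat -> R) : inhabited I ->
  (forall i n, 0 <= F i n <= 1) -> (forall n, 0 <= G n <= 1) ->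
  (forall i n, F i n <= G n) ->
  (forall r : rat, 0 <= r -> (\forall n \near U, G n <= ratr r) \/
     exists i, \forall n \near U, ratr r < F i n) ->
  sup (range (fun i => ulim U (F i))) = ulim U G.
Proof.
move=> inhI F01 G01 FG decide.
have uF01 i : 0 <= ulim U (F i) <= 1 by exact: ulim_itv.
have ubF : has_ubound (range (fun i => ulim U (F i))).
  by exists 1 => _ [i _ <-]; case/andP: (uF01 i).
apply/eqP; rewrite eq_le; apply/andP; split.
  apply: ge_sup; first by case: inhI => i; eexists; exists i.
  by move=> _ [i _ <-]; apply: ulim_le.
rewrite leNgt; apply/negP => /rat_in_itvoo[r].
rewrite in_itv /= => /andP[supr rG].
have r0 : 0 <= r.
  rewrite -(ler0q R); apply: le_trans (ltW supr).
  by case/andP: (range_sup_itv inhI uF01).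
have [Gr|[i rF]] := decide r r0.
  by have := ulim_near_le ultraU G01 Gr; rewrite leNgt rG.
have := @ub_le_sup _ _ ubF (ulim U (F i)) (ex_intro2 _ _ i Logic.I erefl).
rewrite leNgt => /negP; apply; apply: (lt_le_trans supr).
by apply: ulim_near_ge => //; apply: filterS rF => n /ltW.
Qed.

(** An analogue of Łoś's theorem. Implication passes to the limit by continuity; at suprema the
    decisions made along the sequence provide one witness common to [U]-almost all worlds. *)
Lemma henkin_formula_val m (phi : formula S m) : L phi ->
  forall s : 'I_m -> nterm S,
  formula_val (M := henkin) phi (pi \o s) =
  ulim U (fun n => formula_val phi (nterm_val (w n) \o s)).
Proof.
elim: phi => {m}.
- move=> m t u _ s /=.
  have [x xE] := nterm_subst s t; have [y yE] := nterm_subst s u.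
  rewrite (henkin_term_val xE) (henkin_term_val yE) [LHS]mdist_pi.
  by congr ulim; apply/funext => n; rewrite xE yE.
- move=> m P ts _ s /=.
  have /choice[a aE] i := nterm_subst s (ts i).
  rewrite (_ : (fun i => _) = pi \o a); last first.
    by apply/funext => i; exact: henkin_term_val.
  rewrite [LHS]henkin_pinterp; congr ulim; apply/funext => n.
  by congr pinterp; apply/funext => i; rewrite aE.
- by move=> m q _ s /=; rewrite (ulim_eq _ (cvg_cst _)).
- move=> m psi IH1 theta IH2 /(fragment_sub_imp fragL)[Lpsi Ltheta] s /=.
  by rewrite IH1 // IH2 // -ulim_imp // => n; exact: formula_val_itv.
- move=> m psi IH Lphi s /=.
  have Lpsi := fragment_sub_supx fragL Lphi.
  have ord_cons_comp (A : Type) (g : nterm S -> A) x :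
      ord_cons (g x) (g \o s) = g \o ord_cons x s.
    by apply/funext => i; rewrite /ord_cons /=; case: unlift.
  (* Since [pi] is onto, the supremum over the structure is one over terms. *)
  transitivity (sup (range (fun x : nterm S =>
      ulim U (fun n => formula_val psi (nterm_val (w n) \o ord_cons x s))))).
    congr sup; apply/seteqP; split=> _ [a _ <-].
      by exists (rho a) => //; rewrite -IH // -ord_cons_comp rhoK.
    by exists (pi a) => //; rewrite -IH // -ord_cons_comp.
  (* Decisions concern formulas evaluated at the variables themselves, so the parameters [s] are
     first substituted into the formula, which stays in [L]. *)
  have [N /(_ N (leqnn N))[s' s'E]] := nterm_common R T s.
  have s'comp (v : world R T) :
      (fun i => term_val (wprefix v (n := N)) (s' i)) = nterm_val v \o s.
    by apply/funext => i; exact: s'E.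
  have supE (v : world R T) : formula_val (FSupx psi) (nterm_val v \o s) =
      formula_val (fsubst (FSupx psi) s') (wprefix v (n := N)).
    by rewrite formula_val_fsubst s'comp.
  have psiE (v : world R T) x : formula_val psi (nterm_val v \o ord_cons x s) =
      formula_val (fsubst psi (subst_up s'))
        (ord_cons (nterm_val v x) (wprefix v (n := N))).
    rewrite formula_val_fsubst -ord_cons_comp; congr (formula_val _ _).
    by apply/funext => i; rewrite term_val_subst_up s'comp.
  apply: sup_ulim.
  + by exists; exact: nvar 0.
  + by move=> x n; exact: formula_val_itv.
  + by move=> n; exact: (formula_val_itv (FSupx psi)).
  + move=> x n; rewrite -ord_cons_comp.
    apply: ub_le_sup; last by exists (nterm_val (w n) x).
    exists 1 => _ [a _ <-].
    by case/andP: (formula_val_itv psi (ord_cons a (nterm_val (w n) \o s))).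
  + move=> r r0.
    have [B [B_le|[x Bx]] nearB] := supxU (fragment_subst fragL s' Lphi) r0.
      by left; apply: filterS nearB => n /B_le; rewrite -supE.
    by right; exists x; apply: filterS nearB => n /Bx; rewrite -psiE.
- move=> m psi IH Lphi s /=.
  have Lpsi := fragment_sub_supn fragL Lphi.
  transitivity (sup (range (fun k =>
      ulim U (fun n => formula_val (psi k) (nterm_val (w n) \o s))))).
    by congr sup; apply: eq_imagel => k _; rewrite IH.
  have [N /(_ N (leqnn N))[s' s'E]] := nterm_common R T s.
  have substE (v : world R T) (chi : formula S m) :
      formula_val chi (nterm_val v \o s) =
      formula_val (fsubst chi s') (wprefix v (n := N)).
    rewrite formula_val_fsubst; congr (formula_val _ _).
    by apply/funext => i; rewrite s'E.
  apply: sup_ulim.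
  + by exists; exact: 0%N.
  + by move=> k n; exact: formula_val_itv.
  + by move=> n; exact: (formula_val_itv (FSupn psi)).
  + move=> k n; apply: ub_le_sup; last by exists k.
    exists 1 => _ [j _ <-].
    by case/andP: (formula_val_itv (psi j) (nterm_val (w n) \o s)).
  move=> r r0.
  have [B [B_le|[k Bk]] nearB] := supnU (fragment_subst fragL s' Lphi) r0.
    by left; apply: filterS nearB => n /B_le; rewrite -(substE _ (FSupn psi)).
  by right; exists k; apply: filterS nearB => n /Bk; rewrite -substE.
Qed.

End Henkin.

(** * Enumeration of the requirements and assembly of the model *)

Lemma countable_enum (A : Type) (P : set A) (a0 : A) : countable P ->
  exists e : nat -> A, forall x, P x -> exists j, e j = x.
Proof.
move=> /countable_injP[f f_inj].
have /choice[e eP] j : exists x, forall y, P y -> f y = j -> x = y.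
  have [[x [Px <-]]|no] := pselect (exists x, P x /\ f x = j).
    by exists x => y Py /f_inj -> //; rewrite inE.
  by exists a0 => y Py fy; case: no; exists y.
by exists e => x Px; exists (f x); exact: eP.
Qed.

(** Serves to enumerate terms: each [t] is recovered from the formula $d(t,t)$ of [L], so
    countability of [L] suffices. *)
Definition dist_left (S : signature) n (phi : formula S n) :
    option (term S n) :=
  match phi in formula _ n return option (term S n) with
  | FDist _ t _ => Some t
  | _ => None
  end.

(** Lets a countable supremum be indexed by the position of its formula in the enumeration of
    [L]. *)
Definition supn_family (S : signature) n (phi : formula S n) :
    nat -> formula S n :=
  match phi in formula _ n return nat -> formula S n with
  | FSupn _ psi => psi
  | _ => fun=> FConst rat_cc0
  end.

Theorem theoremA (R : realType) (S : signature)
    (L : forall n : nat, set (formula S n))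
    (fragL : fragment L) (countL : forall n : nat, countable (L n))
    (T : set (sentence S)) (TL : subset T (L 0%N))
    (k : nat -> nat) (Sigma : forall n : nat, set (formula S (k n)))
    (typeSigma : forall n : nat, is_type R L T (Sigma n))
    (nonprincipalSigma : forall n : nat, ~ principal R L T (Sigma n)) :
  exists M : structure R S,
    is_model M T /\ forall n : nat, omits M (Sigma n).
Proof.
pose e N := sval (cid (countable_enum (FConst rat_cc0) (countL N))).
have eP N phi : L N phi -> exists j, e N j = phi.
  by rewrite /e; case: cid => ? /=; apply.
pose te (p : nat * nat) : nterm S :=
  if dist_left (e p.1 p.2) is Some t then existT _ p.1 t else nvar S 0.
have teP x : exists p, te p = x.
  case: x => N t; have [j ej] := eP _ _ (fragment_dist fragL t t).
  by exists (N, j); rewrite /te /= ej.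
(* Coding tuples by lists of positions keeps the index type of the requirements countable; missing
   entries default to [te (0, 0)]. *)
pose tuple_of n (l : seq (nat * nat)) (i : 'I_(k n)) := te (nth (0, 0)%N l i).
pose D (i : nat * nat * rat + nat * nat * rat + nat * seq (nat * nat))
    (B : world R T -> Prop) : Prop :=
  match i with
  | inl (inl (N, j, r)) =>
      L _ (FSupx (e N.+1 j)) -> 0 <= r -> decides_supx (e N.+1 j) r B
  | inl (inr (N, j, r)) =>
      let psi := supn_family (e N j) in
      L _ (FSupn psi) -> 0 <= r -> decides_supn psi r B
  | inr (n, l) =>
      exists sigma (q : rat), [/\ Sigma n sigma, q < 1 & forall v, B v ->
        formula_val sigma (nterm_val v \o tuple_of n l) < ratr q]
  end.
have dense i A : condition L A ->
    exists B, [/\ condition L B, forall v, B v -> A v & D i B].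
  case: i => [[[[N j] r]|[[N j] r]]|[n l]] condA /=.
  - have [[Lphi r0]|no] := pselect (L _ (FSupx (e N.+1 j)) /\ 0 <= r).
      have Lpsi := fragment_sub_supx fragL Lphi.
      by have [B [? ? dB]] := dense_supx fragL Lpsi r0 condA; exists B; split.
    by exists A; split=> // ? ?; case: no.
  - have [[Lphi r0]|no] :=
      pselect (L _ (FSupn (supn_family (e N j))) /\ 0 <= r).
      have Lpsi := fragment_sub_supn fragL Lphi.
      by have [B [? ? dB]] := dense_supn fragL Lpsi r0 condA; exists B; split.
    by exists A; split=> // ? ?; case: no.
  - exact: (dense_omit fragL (tuple_of n l) (typeSigma n).1
      (nonprincipalSigma n) condA).
(* That $\Sigma_0$ is a type provides a model of [T], so the trivial condition $1 > 0$ has a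
   world. *)
have [M0 [_ [M0T _]]] := (typeSigma 0%N).2.
have [c] := carrier_inhabited M0.
have cond_true : condition L (fun _ : world R T => True).
  split; last by exists (World M0T (fun=> c)).
  exists 0%N, (FConst (to_rat_cc 1)), 0; split=> // [|v].
    exact: (fragment_const fragL).
  rewrite /= /to_rat_cc -[sval _]/(val _) val_insubd /=.
  by rewrite rmorph0 rmorph1 ltr01.
have condition_ex (A : world R T -> Prop) : condition L A -> exists v, A v.
  by case.
have [w wD] := generic_sequence condition_ex cond_true dense.
(* [U] extends the filter of cofinite sets, so whatever holds eventually along [w] holds [U]-almost
   everywhere. *)
have [U [ultraU ooU]] := ultraFilterLemma (F := \oo) _.
have [M [pi [rho [rhoK mdist_pi]]]] := metric_quotient
  (ndist_refl w ultraU) (ndist_sym w U) (ndist_triangle w ultraU).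
have truth := henkin_formula_val ultraU rhoK mdist_pi fragL.
have {}wD i : exists2 B, D i B & \forall n \near U, B (w n).
  by have [B DB /ooU] := wD i; exists B.
have {}truth m (phi : formula S m) (a : 'I_m -> M) : L m phi ->
    formula_val (M := henkin ultraU rhoK mdist_pi) phi a =
    ulim U (fun n => formula_val phi (nterm_val (w n) \o (rho \o a))).
  move=> Lphi; rewrite -truth //.
  - by congr (formula_val _ _); apply/funext => i /=; rewrite rhoK.
  - move=> N psi r Lpsi r0.
    have [j ej] := eP _ _ (fragment_sub_supx fragL Lpsi).
    by have [B dB] := wD (inl (inl (N, j, r))); exists B => //;
      move: dB; rewrite /= ej; apply.
  - move=> N psi r Lpsi r0.
    have [j ej] := eP _ _ Lpsi.
    by have [B dB] := wD (inl (inr (N, j, r))); exists B => //;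
      move: dB; rewrite /= ej; apply.
exists (henkin ultraU rhoK mdist_pi); split.
  (* Sentences of [T] have value 1 in every world, hence in the limit. *)
  move=> phi v Tphi; rewrite /satisfies truth; last exact: TL.
  apply: ulim_eq; rewrite (_ : (fun n => _) = cst 1); first exact: cvg_cst.
  by apply/funext => n; exact: wmodelP.
move=> n a realizes_a.
have /choice[p pE] i := teP (rho (a i)).
pose l := [seq p i | i <- enum 'I_(k n)].
have lE : tuple_of n l = rho \o a.
  apply/funext => i; rewrite /tuple_of /l (nth_map i) ?size_enum_ord //.
  by rewrite nth_ord_enum pE.
(* The requirement for this tuple of names puts some [sigma] below [q] at [U]-almost all worlds, so
   its limit value is at most $q < 1$. *)
have [B [sigma [q [Ssigma q1 Bq]]] nearB] := wD (inr (n, l)).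
have := realizes_a sigma Ssigma.
rewrite /satisfies truth; last exact: (typeSigma n).1.
apply/eqP; rewrite lt_eqF //; apply: (@le_lt_trans _ _ (ratr q)).
  apply: ulim_near_le => [j|]; first exact: formula_val_itv.
  by apply: filterS nearB => j /Bq; rewrite lE => /ltW.
by rewrite -(rmorph1 (@ratr R)) ltr_rat.
Qed.
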